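(* Let $\lambda,\mu,\kappa$ be cardinals with $\lambda>\mu\ge\operatorname{cf}(\lambda)=\kappa$ and assume $\operatorname{cov}(\lambda,\mu,\kappa,2)=\lambda$. If $\langle P,\le\rangle$ is a poset of cofinality $\lambda$, then $P$ contains an antichain of size $\kappa$.
   Context: A cardinal $\lambda$ with $\lambda>\operatorname{cf}(\lambda)$ is a singular (in particular infinite) cardinal. For a set $A$ and a cardinal $\mu$, $[A]^{<\mu}:=\{X\subseteq A\mid |X|<\mu\}$. For cardinals $\lambda\ge\kappa\ge\sigma>1$ and $\mu\ge\kappa+\aleph_0$, let $$\operatorname{cov}(\lambda,\mu,\kappa,\sigma):=\min\{|D|\mid D\subseteq[\lambda]^{<\mu},\ \forall A\in[\lambda]^{<\kappa}\ \exists B\in[D]^{<\sigma}\ (A\subseteq\bigcup B)\}.$$ Let $\langle P,\le\rangle$ be a poset (partially ordered set). A subset $A\subseteq P$ is cofinal in $P$ iff for every $x\in P$ there is $y\in A$ with $x\le y$; the cofinality of the poset is the least cardinality of a cofinal subset of $P$. Elements $x,y\in P$ are incomparable iff $x\not\le y$ and $y\not\le x$; $A\subseteq P$ is an antichain iff all distinct $x,y\in A$ are incomparable. *)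

(* Defs.v *)
From HB Require Import structures.
From mathcomp Require Import all_boot all_order.
From mathcomp Require Import boolp classical_sets functions cardinality wochoice.

Set Implicit Arguments.
Unset Strict Implicit.
Unset Printing Implicit Defensive.
Import Order.TTheory.

Local Open Scope order_scope.
Local Open Scope classical_set_scope.
Local Open Scope card_scope.

Definition card_lt (T U : Type) (A : set T) (B : set U) : bool :=
  (A #<= B) && ~~ (B #<= A).

(* Cardinals are initial ordinals: a well-order all of whose proper initial
   segments are strictly smaller than the whole. When only the size of a
   cardinal matters, it is represented by the underlying type. *)
Record cardinal : Type := Cardinal {
  cardinal_disp : Order.disp_t ;
  cardinal_sort :> orderType cardinal_disp ;
  cardinal_well_order : well_order (<=%O : rel cardinal_sort) ;
  cardinal_initial : forall x : cardinal_sort,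
    card_lt [set y | y < x] [set: cardinal_sort] }.

(* |N| = min {|D| : F D} *)
Definition is_min_card (U : Type) (F : set U -> Prop) (N : Type) : Prop :=
  (exists D : set U, F D /\ D #= [set: N]) /\
  (forall D : set U, F D -> [set: N] #<= D).

Definition cofinal_in (d : Order.disp_t) (P : porderType d) (A : set P) : Prop :=
  forall x : P, exists2 y : P, A y & x <= y.

(* The cofinality of the poset P is |N|. For a cardinal lambda, taken as a
   well-ordered poset, this says cf(lambda) = |N|. *)
Definition is_cofinality (d : Order.disp_t) (P : porderType d) (N : Type) :
    Prop :=
  is_min_card (@cofinal_in d P) N.

(* D is a subset of [L]^{<M} such that every A in [L]^{<K} is covered by the
   union of some B in [D]^{<S}. *)
Definition covering_family (L M K S : Type) (D : set (set L)) : Prop :=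
  (forall X : set L, D X -> card_lt X [set: M]) /\
  (forall A : set L, card_lt A [set: K] ->
     exists B : set (set L),
       [/\ B `<=` D, card_lt B [set: S] & A `<=` \bigcup_(X in B) X]).

(* cov(|L|, |M|, |K|, |S|) = |N|; cov(L, M, K, S) is only defined for
   L >= K >= S > 1 and M >= K + aleph_0. *)
Definition is_cov (L M K S N : Type) : Prop :=
  [/\ [set: K] #<= [set: L], [set: S] #<= [set: K],
      card_lt [set: unit] [set: S], [set: K + nat] #<= [set: M] &
      is_min_card (@covering_family L M K S) N].

Definition antichain (d : Order.disp_t) (P : porderType d) (A : set P) : Prop :=
  forall x y : P, A x -> A y -> x <> y -> x >< y.

(* Main.v *)
(**
Replace P by the preorder r that a cofinal sequence indexed by lambda pulls back
to lambda. It suffices to find a family Z of mu * kappa points such that every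
A of size < kappa, no element of which is r-below a point of Z, is extended by
some x unrelated to all of A and not r-below a point of Z: a maximal antichain
off the r-down-closure of Z then has size >= kappa.

Let c : kappa -> lambda be cofinal and d enumerate the covering family. The
points z i g of Z are chosen by recursion on i in mu. Let C i B e be the set of
b in B unrelated to z j g for all j < i and all g with e <= c g. Then z i g is
chosen not r-below any a < c g, and also not r-below any of the mu * kappa
points that dominate the set of all x unrelated to C i (d b) e, for every
b, e < c g for which such a dominating set exists; fewer than lambda points have
to be avoided.

Given A, choose e above A and b with A included in d b; then A is included in
every C i (d b) e. These sets decrease with i inside d b, of size < mu, so
at some i nothing is removed, i.e. z i g is unrelated to C i (d b) e for all g
with e <= c g. For c g > b, e the choice of z i g shows that the points
unrelated to C i (d b) e are not dominated by any mu * kappa points, in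
particular not by Z.
*)

Require Import Defs.
From HB Require Import structures.
From mathcomp Require Import all_boot all_order.
From mathcomp Require Import boolp classical_sets functions cardinality wochoice.

Set Implicit Arguments.
Unset Strict Implicit.
Unset Printing Implicit Defensive.
Import Order.TTheory.

Local Open Scope order_scope.
Local Open Scope classical_set_scope.
Local Open Scope card_scope.

(** * Comparing cardinalities through injective relations *)

(** Injections can be given by their graphs: no value has to be named outside [A], and witnesses are
    chosen only in this proof. *)
Lemma card_le_relP T U (A : set T) (B : set U) :
  A #<= B <-> exists K : T -> U -> Prop,
    (forall x, A x -> exists2 y, B y & K x y) /\
    (forall x x' y, A x -> A x' -> K x y -> K x' y -> x = x').
Proof.
split=> [/card_leP[f]|[K [totK injK]]].
  exists (fun x y => exists a : A, x = val a /\ y = val (f a)); split.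
    move=> x /mem_set Ax; exists (val (f (SigSub Ax))); last by exists (SigSub Ax).
    exact: set_valP.
  move=> x x' y _ _ [a [-> ->]] [a' [-> /val_inj faa']].
  by congr val; apply: (@inj _ _ _ f); rewrite ?inE.
have /choice[f fP] (a : A) : exists b : B, K (val a) (val b).
  have [y By Ky] := totK _ (set_valP a).
  by exists (SigSub (mem_set By)).
have fI : set_inj [set: A] f.
  move=> a a' _ _ faa'; apply/val_inj.
  by apply: (injK _ _ (val (f a))); rewrite ?faa' //; try exact: set_valP; rewrite -faa'.
by apply/card_leP/injfunPex; exists f.
Qed.

(** By Zorn, take a maximal partial injection [G]: if it missed a point on each side, that pair
    could be added. *)
Lemma card_le_total T U (A : set T) (B : set U) : A #<= B \/ B #<= A.
Proof.
pose inj (G : set (T * U)) :=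
  [/\ (forall p, G p -> A p.1 /\ B p.2),
      (forall x y y', G (x, y) -> G (x, y') -> y = y') &
      (forall x x' y, G (x, y) -> G (x', y) -> x = x')].
have [F Finj totF|G [[GAB Gfun Ginj] Gmax]] := @Zorn_bigcup _ inj.
  have common p q : (\bigcup_(X in F) X) p -> (\bigcup_(X in F) X) q ->
      exists X, [/\ F X, X p & X q].
    move=> [X FX Xp] [Y FY Yq].
    by have [XY|YX] := totF X Y FX FY;
      [exists Y; split=> //; exact: XY | exists X; split=> //; exact: YX].
  split=> [p [X /Finj[XAB _ _] /XAB//]|x y y' xy xy'|x x' y xy x'y].
    by have [X [/Finj[_ Xfun _] ? ?]] := common _ _ xy xy'; apply: (Xfun x).
  by have [X [/Finj[_ _ Xinj] ? ?]] := common _ _ xy x'y; apply: (Xinj _ _ y).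
have [domG|/existsNP[x /not_implyP[Ax Nx]]] :=
  pselect (forall x, A x -> exists y, G (x, y)).
  left; apply/card_le_relP; exists (fun x y => G (x, y)); split=> [x Ax|x x' y _ _].
    by have [y Gxy] := domG x Ax; exists y => //; have [] := GAB _ Gxy.
  exact: Ginj.
have [ranG|/existsNP[y /not_implyP[By Ny]]] :=
  pselect (forall y, B y -> exists x, G (x, y)).
  right; apply/card_le_relP; exists (fun y x => G (x, y)); split=> [y By|y y' x' _ _].
    by have [x' Gxy] := ranG y By; exists x' => //; have [] := GAB _ Gxy.
  exact: Gfun.
case: (Gmax (G `|` [set (x, y)])).
  by split=> [p ?|/(_ (x, y) (or_intror erefl)) Gxy]; [left|apply: Nx; exists y].
split=> [p [/GAB//|->//]|a b b' [Gab|[-> ->]] [Gab'|[]]|a a' b [Gab|[-> ->]] [Ga'b|[]]].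
- exact: (Gfun a).
- by move=> ax; case: Nx; exists b; rewrite -ax.
- by case: Nx; exists b'.
- by move=> ->.
- exact: (Ginj _ _ b).
- by move=> _ bx; case: Ny; exists a; rewrite -bx.
- by case: Ny; exists a'.
- by move=> ->.
Qed.

Lemma card_ltE T U (A : set T) (B : set U) : card_lt A B <-> ~ (B #<= A).
Proof.
split=> [/andP[_ /negP//]|NBA]; apply/andP; split; last exact/negP.
by have [] := card_le_total A B.
Qed.

Lemma card_leX T T' U U' (A : set T) (A' : set T') (B : set U) (B' : set U') :
  A #<= A' -> B #<= B' -> A `*` B #<= A' `*` B'.
Proof.
move=> /card_le_relP[K [totK injK]] /card_le_relP[H [totH injH]].
apply/card_le_relP; exists (fun p q => K p.1 q.1 /\ H p.2 q.2); split.
  move=> [x y] /= [/totK[x' A'x' Kxx'] /totH[y' B'y' Hyy']].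
  by exists (x', y').
move=> [x y] [x' y'] [a b] /= [Ax By] [Ax' By'] [Kx Hy] [Kx' Hy'].
by congr (_, _); [apply: (injK _ _ a)|apply: (injH _ _ b)].
Qed.

(** The second coordinate, [c0] or [c1], records from which of the two sets a point is taken. *)
Lemma card_setU_le_setX T U (A B : set T) (C : set U) (c0 c1 : U) :
  C c0 -> C c1 -> c0 <> c1 -> A #<= C -> B #<= C -> A `|` B #<= C `*` C.
Proof.
move=> C0 C1 c01 /card_le_relP[K [totK injK]] /card_le_relP[H [totH injH]].
apply/card_le_relP; exists (fun x p =>
    (A x /\ K x p.1 /\ p.2 = c0) \/ (B x /\ H x p.1 /\ p.2 = c1)).
split=> [x [Ax|Bx]|x x' [c i] _ _ /=].
- by have [y Cy Ky] := totK x Ax; exists (y, c0) => //; left.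
- by have [y Cy Hy] := totH x Bx; exists (y, c1) => //; right.
move=> [|] [? [? ->]] [|] [? [? e]] //.
- exact: (injK _ _ c).
- by case: c01; rewrite e.
- exact: (injH _ _ c).
Qed.

(** * Squares, products and unions of infinite sets *)

Lemma infinite_set_neq T (A : set T) : infinite_set A ->
  exists x y, [/\ A x, A y & x <> y].
Proof.
move=> /infiniteP/card_le_relP[K [totK injK]].
have [x Ax Kx] := totK 0%N I; have [y Ay Ky] := totK 1%N I.
exists x, y; split=> // xy; rewrite -xy in Ky.
by have := injK 0%N 1%N x I I Kx Ky.
Qed.

Lemma infinite_injection T (A : set T) : infinite_set A ->
  exists2 k : nat -> T, injective k & forall n, A (k n).
Proof.
move=> /infiniteP/card_le_relP[K [totK injK]].
have /choice[k kP] n : exists x, A x /\ K n x.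
  by have [x Ax Kx] := totK n I; exists x.
exists k => [m n kmn|n]; last by have [] := kP n.
have [_ Km] := kP m; have [_ Kn] := kP n.
by apply: (injK m n (k m)) => //; rewrite kmn.
Qed.

Lemma infinite_setX_le T (A : set T) : infinite_set A -> A `*` A #<= A.
Proof.
move=> Ainf.
(* Take a maximal [G] relating [dom G `*` dom G] injectively to [dom G]; if
   [dom G] is smaller than [A], then [G] extends to [dom G] and a disjoint copy. *)
pose dom (G : set (T * T * T)) : set T := [set x | exists z, G (x, x, z)].
pose good (G : set (T * T * T)) := [/\ dom G `<=` A,
    (forall x y, dom G x -> dom G y -> exists2 z, dom G z & G (x, y, z)),
    (forall x y z, G (x, y, z) -> [/\ dom G x, dom G y & dom G z]) &
    (forall x y x' y' z, G (x, y, z) -> G (x', y', z) -> x = x' /\ y = y')].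
have domS G G' : G `<=` G' -> dom G `<=` dom G'.
  by move=> GG' x [y /GG' ?]; exists y.
have [k k_inj kA] := infinite_injection Ainf.
(* A countable start: [pickle] codes pairs of naturals, so the range of [k] is paired into
   itself. *)
pose G0 : set (T * T * T) := [set (k p.1, k p.2, k (pickle p)) | p in [set: nat * nat]].
have domG0 n : dom G0 (k n) by exists (k (pickle (n, n))), (n, n).
have goodG0 : good G0.
  split=> [x [z [p _ [<- _ _]]]//|x y|x y z [p _ [<- <- <-]]|] //.
    move=> [_ [[m _] _ [<- _ _]]] [_ [[n _] _ [<- _ _]]] /=.
    by exists (k (pickle (m, n))) => //; exists (m, n).
  move=> x y x' y' z [p _ [<- <- <-]] [q _ [<- <- /k_inj]].
  by move=> /(pcan_inj pickleK) ->.
(* The alternative [G = set0] serves the union of an empty chain; it is excluded afterwards, since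
   [G0] properly extends the empty relation. *)
have [F FP totF|G [PG Gmax]] :=
    @Zorn_bigcup _ (fun G => G = set0 \/ (G0 `<=` G /\ good G)).
  have [F0|/existsNP[X0 /not_implyP[FX0 X0n0]]] :=
    pselect (forall X, F X -> X = set0).
    by left; apply/seteqP; split=> // p [X /F0 ->].
  have [//|[G0X0 _]] := FP _ FX0.
  right; split; first by move=> p /G0X0 ?; exists X0.
  have Fgood X p : F X -> X p -> good X.
    by move=> FX Xp; have [X0'|[]//] := FP _ FX; move: Xp; rewrite X0'.
  have common p q : (\bigcup_(X in F) X) p -> (\bigcup_(X in F) X) q ->
      exists X, [/\ F X, X p & X q].
    move=> [X FX Xp] [Y FY Yq].
    by have [XY|YX] := totF X Y FX FY;
      [exists Y; split=> //; exact: XY | exists X; split=> //; exact: YX].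
  have sub X : F X -> X `<=` \bigcup_(X in F) X by move=> FX p Xp; exists X.
  split.
  - move=> x [z [X FX Xx]]; have [XA _ _ _] := Fgood _ _ FX Xx.
    by apply: XA; exists z.
  - move=> x y [x' Gx] [y' Gy]; have [X [FX Xx Xy]] := common _ _ Gx Gy.
    have [_ + _ _] := Fgood _ _ FX Xx; move=> /(_ x y) [||z Xz Xxyz].
    + by exists x'.
    + by exists y'.
    + by exists z; [exact: domS (sub _ FX) _ Xz|exists X].
  - move=> x y z [X FX Xxyz]; have [_ _ /(_ _ _ _ Xxyz)[? ? ?] _] := Fgood _ _ FX Xxyz.
    by split; exact: domS (sub _ FX) _ _.
  - move=> x y x' y' z Gz Gz'; have [X [FX Xz Xz']] := common _ _ Gz Gz'.
    by have [_ _ _] := Fgood _ _ FX Xz; apply; [exact: Xz|].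
have {PG} [G00|[G0G [GA Gtot Gdom Ginj]]] := PG.
  case: (Gmax G0); last by right; split.
  rewrite G00; split=> [p []|G0_0].
  by case: (G0_0 (k 0%N, k 0%N, k (pickle (0%N, 0%N)))); exists (0%N, 0%N).
pose B := dom G.
have BkB n : B (k n) by exact: domS (domG0 n).
have BXB : B `*` B #<= B.
  apply/card_le_relP; exists (fun p z => G (p.1, p.2, z)); split.
    by move=> [x y] [/= Bx By]; exact: Gtot.
  move=> [x y] [x' y'] z _ _ /= Gz Gz'.
  by have [-> ->] := Ginj _ _ _ _ _ Gz Gz'.
have k01 : k 0%N <> k 1%N by move=> /k_inj.
(* If [A] without [B] is no larger than [B], then [A] embeds in the square of [B], hence in [B].
   Otherwise there is room for a copy [B'] of [B] outside [B]. *)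
have [AB|/card_le_relP[K [totK injK]]] := card_le_total (A `\` B) B.
  have AleB : A #<= B.
    apply: card_le_trans (BXB); rewrite -(setDUK GA) -/B.
    exact: card_setU_le_setX k01 (card_lexx _) AB.
  apply: card_le_trans (card_leX AleB AleB) _; apply: card_le_trans (BXB) _.
  exact: subset_card_le.
have /choice[h hP] x : exists y, B x -> (A `\` B) y /\ K x y.
  by have [/totK[y ? ?]|?] := pselect (B x); [exists y|exists x].
have hA x : B x -> (A `\` B) (h x) by move=> /hP[].
have h_inj x x' : B x -> B x' -> h x = h x' -> x = x'.
  move=> Bx Bx' hxx'; apply: (injK x x' (h x)) => //; first by have [] := hP x Bx.
  by rewrite hxx'; have [] := hP x' Bx'.
pose B' := h @` B.
have BleB' : B #<= B'.
  apply/card_le_relP; exists (fun x y => h x = y); split=> [x Bx|x x' y Bx Bx' <- ?].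
    by exists (h x) => //; exists x.
  exact: h_inj.
have NBB' y : B y -> B' y -> False by move=> By [x /hA[_ +] hx]; rewrite hx.
have /card_le_relP[H [totH injH]] : (B `|` B') `*` (B `|` B') #<= B'.
  apply: card_le_trans BleB'; apply: card_le_trans (BXB).
  suff C : B `|` B' #<= B by exact: card_leX.
  apply: card_le_trans (BXB).
  exact: card_setU_le_setX k01 (card_lexx _) (card_image_le _ _).
(* The pairs not yet treated by [G] take their values in [B'], so they cannot collide with values of
   [G]. *)
pose D := [set p : T * T * T | [/\ (B `|` B') p.1.1, (B `|` B') p.1.2,
  ~ (B p.1.1 /\ B p.1.2), B' p.2 & H p.1 p.2]].
have domD : dom (G `|` D) = B `|` B'.
  apply/seteqP; split=> x; first by move=> [z [Gz|[]//]]; left; exists z.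
  move=> [[z Gz]|B'x]; first by exists z; left.
  have [|z B'z Hz] := totH (x, x); first by split; right.
  by exists z; right; split=> //=; [right|right|move=> [/NBB'/(_ B'x)]].
case: (Gmax (G `|` D)).
  split=> [p ?|DG]; first by left.
  have : (B `|` B') (h (k 0%N)) by right; exists (k 0%N).
  rewrite -domD => -[z Dz].
  by have [_] := hA _ (BkB 0%N); apply; exists z; apply: DG.
right; split; first by move=> p /G0G; left.
split; rewrite ?domD.
- by move=> x [/GA//|[y By <-]]; have [] := hA y By.
- move=> x y Dx Dy; have [[Bx By]|NBxy] := pselect (B x /\ B y).
    by have [z Bz Gz] := Gtot x y Bx By; exists z; left.
  by have [|z B'z Hz] := totH (x, y) => //; exists z; right.
- move=> x y z [/Gdom[? ? ?]|[/= ? ? _ ? _]]; first by split; left.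
  by split=> //; right.
- move=> x y x' y' z [Gz|[/= Dx Dy _ B'z Hz]] [Gz'|[/= Dx' Dy' _ B'z' Hz']].
  + exact: Ginj Gz Gz'.
  + by have [_ _ Bz] := Gdom _ _ _ Gz; case: (NBB' z).
  + by have [_ _ Bz] := Gdom _ _ _ Gz'; case: (NBB' z).
  + by have [] := injH (x, y) (x', y') z (conj Dx Dy) (conj Dx' Dy') Hz Hz'.
Qed.

(** The largest of [N], [A] and [B] serves as [D]; products and unions are then bounded by the
    square of this one infinite set. *)
Lemma infinite_card_ub T U V W (C : set T) (N : set U) (A : set V) (B : set W) :
    infinite_set N -> ~ (C #<= N) -> ~ (C #<= A) -> ~ (C #<= B) ->
  exists X (D : set X), [/\ infinite_set D, A #<= D, B #<= D & ~ (C #<= D)].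
Proof.
move=> Ninf NCN NCA NCB.
have inf X (D : set X) : N #<= D -> infinite_set D by move=> ND /(card_le_finite ND).
have [AB|BA] := card_le_total A B.
  have [BN|NB] := card_le_total B N.
    by exists U, N; split=> //; exact: card_le_trans AB BN.
  by exists W, B; split=> //; exact: inf.
have [AN|NA] := card_le_total A N.
  by exists U, N; split=> //; exact: card_le_trans BA AN.
by exists V, A; split=> //; exact: inf.
Qed.

Lemma not_card_le_setX T U V W (C : set T) (N : set U) (A : set V) (B : set W) :
    infinite_set N -> ~ (C #<= N) -> ~ (C #<= A) -> ~ (C #<= B) ->
  ~ (C #<= A `*` B).
Proof.
move=> Ninf NCN NCA NCB CAB.
have [X [D [Dinf AD BD NCD]]] := infinite_card_ub Ninf NCN NCA NCB; apply: NCD.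
apply: card_le_trans CAB _.
exact: card_le_trans (card_leX AD BD) (infinite_setX_le Dinf).
Qed.

Lemma not_card_le_setU T U V (C : set T) (N : set U) (A B : set V) :
    infinite_set N -> ~ (C #<= N) -> ~ (C #<= A) -> ~ (C #<= B) ->
  ~ (C #<= A `|` B).
Proof.
move=> Ninf NCN NCA NCB CAB.
have [X [D [Dinf AD BD NCD]]] := infinite_card_ub Ninf NCN NCA NCB; apply: NCD.
have [c0 [c1 [D0 D1 c01]]] := infinite_set_neq Dinf.
apply: card_le_trans CAB _; apply: card_le_trans (infinite_setX_le Dinf).
exact: card_setU_le_setX c01 AD BD.
Qed.

(** * Recursion along a cardinal *)

Lemma cardinal_lt_wf (k : cardinal) : well_founded (fun x y : k => x < y).
Proof.
move=> x; apply: contrapT => Nx.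
pose A := [pred y : k | `[< ~ Acc (fun x y : k => x < y) y >]].
have [|z [[/asboolP Az zmin] _]] := @cardinal_well_order k A.
  by exists x; apply/asboolP.
apply: Az; constructor => y yz.
apply: contrapT => Ny.
have : y \in A by apply/asboolP.
by move=> /zmin; rewrite leNgt yz.
Qed.

(** A choice function for [R] is fixed in advance and iterated by well-founded recursion; the
    extensionality hypothesis says that [R i] sees only the values below [i]. *)
Lemma wf_choice (I X : Type) (lt : I -> I -> Prop) (x0 : X)
    (R : I -> (I -> X) -> X -> Prop) : well_founded lt ->
  (forall i f g x, (forall j, lt j i -> f j = g j) -> R i f x -> R i g x) ->
  (forall i f, exists x, R i f x) ->
  exists F, forall i, R i F (F i).
Proof.
move=> ltwf Rext Rex.
have /choice[s sP] (p : I * (I -> X)) : exists x, R p.1 p.2 x by exact: Rex.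
(* The history below [i] is completed by the arbitrary default [x0]. *)
pose total i (h : forall j, lt j i -> X) j :=
  if pselect (lt j i) is left ji then h j ji else x0.
pose step i h := s (i, total i h).
pose F := Fix ltwf (fun=> X) step.
have FE i : F i = s (i, total i (fun j _ => F j)).
  rewrite /F Fix_eq // => j g h gh; congr (s (j, _)).
  by apply/funext => k; rewrite /total; case: pselect.
exists F => i; rewrite FE; move: (sP (i, total i (fun j _ => F j))).
apply: (Rext i (total i (fun j _ => F j)) F) => j ji.
by rewrite /total; case: pselect.
Qed.

(** * The separating family of points *)

Definition unrelated T (r : T -> T -> Prop) (x y : T) := ~ r x y /\ ~ r y x.

Lemma card_eq_range T U (A : set T) : A #= [set: U] ->
  exists f : U -> T, range f = A.
Proof.
rewrite card_eq_sym => /card_bijP[f [g fK gK]].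
have UT u : u \in [set: U] by rewrite inE.
exists (fun u => val (f (SigSub (UT u)))).
apply/seteqP; split=> [_ [u _ <-]|x /mem_set Ax].
  exact: set_valP.
exists (val (g (SigSub Ax))) => //.
rewrite (_ : SigSub _ = g (SigSub Ax)) ?gK //; exact: val_inj.
Qed.

(** This makes a maximal set of pairwise unrelated points, none [r]-below a [z i g], have size at
    least [kappa]: a smaller one could be extended by [x]. *)
Lemma separating_family (lambda mu kappa : cardinal)
    (hmu : card_lt [set: mu] [set: lambda])
    (hkappa : [set: kappa] #<= [set: mu])
    (hcf : is_cofinality lambda kappa)
    (hcov : is_cov lambda mu kappa 'I_2 lambda)
    (r : lambda -> lambda -> Prop)
    (rcof : forall Y : set lambda, (forall x, exists2 y, Y y & r x y) ->
      [set: lambda] #<= Y) :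
  exists z : mu -> kappa -> lambda, forall A : set lambda,
    card_lt A [set: kappa] -> (forall a, A a -> forall i g, ~ r a (z i g)) ->
    exists2 x, forall i g, ~ r x (z i g) & forall a, A a -> unrelated r x a.
Proof.
have [_ k2 _ kmu [[D [[Dmu Dcov] Dcard]] _]] := hcov.
have [[Cof [Cofcof Cofcard]] cfmin] := hcf.
have muinf : infinite_set [set: mu].
  apply/infiniteP; apply: card_le_trans kmu.
  apply/card_le_relP; exists (fun n s => s = inr n).
  by split=> [n|m n s _ _ -> []] //; exists (inr n).
have NLmu := (card_ltE _ _).1 hmu.
have NLkappa : ~ ([set: lambda] #<= [set: kappa]).
  by move=> Lk; apply: NLmu; apply: card_le_trans Lk hkappa.
(* A largest element would be cofinal by itself, forcing [kappa] to be at most 1, whereas [is_cov]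
   puts 2 below [kappa]. *)
have unbounded (x : lambda) : exists y, x < y.
  apply: contrapT => /forallNP nlt.
  have : [set: kappa] #<= [set x].
    by apply: cfmin => y; exists x => //; rewrite leNgt; apply/negP; exact: nlt.
  move=> /(card_le_trans k2)/card_le_relP[K [totK injK]].
  have [_ -> K0] := totK ord0 I; have [_ -> K1] := totK ord_max I.
  by have := injK _ _ _ I I K0 K1.
have [c c_cof] : exists c : kappa -> lambda, forall x, exists g, x < c g.
  have [f fE] := card_eq_range Cofcard.
  exists f => x; have [y xy] := unbounded x; have [z] := Cofcof y.
  by rewrite -fE => -[g _ <-] yz; exists g; exact: lt_le_trans xy yz.
have [d dE] := card_eq_range Dcard.
pose C i (z : mu -> kappa -> lambda) (B : set lambda) (e : lambda) : set lambda :=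
  [set b | B b /\ forall j, j < i -> forall g, e <= c g -> unrelated r (z j g) b].
pose dominates (f : mu * kappa -> lambda) (E : set lambda) :=
  forall x, (forall b, E b -> unrelated r x b) -> exists p, r x (f p).
have /choice[w wP] (E : set lambda) :
    exists f, (exists f', dominates f' E) -> dominates f E.
  have [[f fE]|nE] := pselect (exists f', dominates f' E); first by exists f.
  (* Without a dominating family any value of [w] will do. *)
  by exists (fun p => c p.2) => /nE.
pose R i (z : mu -> kappa -> lambda) (y : kappa -> lambda) := forall g,
  (forall a, a < c g -> ~ r (y g) a) /\
  (forall b e p, b < c g -> e < c g -> ~ r (y g) (w (C i z (d b) e) p)).
have Rex i z : exists y, R i z y.
  suff /choice[y yP] g : exists x, (forall a, a < c g -> ~ r x a) /\
      (forall b e p, b < c g -> e < c g -> ~ r x (w (C i z (d b) e) p)).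
    by exists y.
  pose S := [set a | a < c g].
  have NLS : ~ ([set: lambda] #<= S) by apply/card_ltE; exact: cardinal_initial.
  (* All points that [y g] must avoid. They are fewer than [lambda], so they do not dominate, and
     some [x] is [r]-below none of them. *)
  pose Y := S `|` (fun q => w (C i z (d q.1.1) q.1.2) q.2) @`
    (S `*` S `*` ([set: mu] `*` [set: kappa])).
  have NLX := not_card_le_setX muinf NLmu
    (not_card_le_setX muinf NLmu NLS NLS) (not_card_le_setX muinf NLmu NLmu NLkappa).
  have : ~ ([set: lambda] #<= Y).
    apply: (not_card_le_setU muinf NLmu NLS) => LY.
    exact: NLX (card_le_trans LY (card_image_le _ _)).
  move=> NLY; apply: contrapT => NY; apply: NLY.
  apply: rcof => x; apply: contrapT => xY; apply: NY.
  exists x; split=> [a ag xa|b e p bg eg xw]; apply: xY.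
    by exists a => //; left.
  by exists (w (C i z (d b) e) p) => //; right; exists (b, e, p).
have Rext i z z' y : (forall j, j < i -> z j = z' j) -> R i z y -> R i z' y.
  move=> zz' Rzy; have CE B e : C i z' B e = C i z B e.
    by apply/seteqP; split=> b [Bb Cb]; split=> // j ji g eg;
      [rewrite zz'|rewrite -zz']; try exact: ji; exact: Cb.
  by move=> g; have [? Rg] := Rzy g; split=> // b e p; rewrite CE; exact: Rg.
have [z zP] := wf_choice c (@cardinal_lt_wf mu) Rext Rex.
exists z => A Ak Az.
(* A set smaller than the cofinality [kappa] is not cofinal, hence strictly bounded. *)
have [e Ae] : exists e, forall a, A a -> a < e.
  apply: contrapT => /forallNP Ne; apply: (card_ltE _ _).1 Ak _.
  apply: cfmin => x; have /existsNP[a /not_implyP[Aa /negP]] := Ne x.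
  by rewrite -leNgt => ?; exists a.
have [b Adb] : exists b, A `<=` d b.
  have [B [BD /card_ltE B2 AB]] := Dcov A Ak.
  (* A cover of size below 2 has at most one member. *)
  have Buniq X X' : B X -> B X' -> X = X'.
    move=> BX BX'; apply: contrapT => XX'; apply: B2; apply/card_le_relP.
    exists (fun n Y => Y = if n == ord0 :> 'I_2 then X else X'); split=> [n _|m n Y _ _].
      by exists (if n == ord0 then X else X') => //; case: ifP.
    case: m => -[|[|//]] m2; case: n => -[|[|//]] n2 /= -> e'.
    - exact/val_inj.
    - by case: XX'.
    - by case: XX'.
    - exact/val_inj.
  have [[X BX]|NB] := pselect (exists X, B X).
    have [b _ dbX] : range d X by rewrite dE; exact: BD.
    by exists b; rewrite dbX => a /AB[X' BX' X'a]; rewrite (Buniq X X').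
  (* With no member in the cover, [A] is empty and any index works, for instance [e]. *)
  by exists e => a /AB[X BX _]; case: NB; exists X.
(* Otherwise each stage [i] removes some point of [d b] from all later sets [C]; distinct stages
   remove distinct points, so [mu] would embed in [d b]. *)
have [i iP] : exists i, forall g, e <= c g ->
    forall a, C i z (d b) e a -> unrelated r (z i g) a.
  apply: contrapT => /forallNP Ni.
  have /card_ltE : card_lt (d b) [set: mu] by apply: Dmu; rewrite -dE; exists b.
  apply; apply/card_le_relP.
  exists (fun i a => C i z (d b) e a /\ exists2 g, e <= c g & ~ unrelated r (z i g) a).
  split=> [i _|i j a _ _ [Cia [g eg Ng]] [Cja [g' eg' Ng']]].
    have /existsNP[g /not_implyP[eg /existsNP[a /not_implyP[Ca Na]]]] := Ni i.
    by exists a; [case: Ca | split=> //; exists g].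
  by have [ij|ji|//] := ltgtP i j; [case: Ng; apply: Cja.2|case: Ng'; apply: Cia.2].
(* With [c g] above both [e] and [b], the choice of [z i g] took [C i z (d b) e] into account. *)
have [g] := c_cof (Order.max e b); rewrite gt_max => /andP[eg bg].
have AC a : A a -> C i z (d b) e a.
  move=> Aa; split=> [|j _ g' eg']; first exact: Adb.
  split; last exact: Az.
  by apply: (zP j g').1; exact: lt_le_trans (Ae a Aa) eg'.
(* If this set had a dominating family, [w] would give one; as [z i g] is unrelated to the whole
   set, it would lie [r]-below some value of [w], which its choice forbids. *)
have ndom f : ~ dominates f (C i z (d b) e).
  move=> /(ex_intro _ f)/wP /(_ (z i g)) [|p]; last exact: (zP i g).2.
  by apply: iP; exact: ltW.
(* In particular the family [z] itself does not dominate, and this produces [x]. *)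
have /existsNP[x /not_implyP[xC Nx]] := ndom (fun p => z p.1 p.2).
exists x => [j h xz|a Aa]; first by apply: Nx; exists (j, h).
exact/xC/AC.
Qed.

(** * From a maximal set of unrelated indices to an antichain of the poset *)

Theorem corollary2p9 (lambda mu kappa : cardinal)
    (hmu : card_lt [set: mu] [set: lambda])
    (hkappa : [set: kappa] #<= [set: mu])
    (hcf : is_cofinality lambda kappa)
    (hcov : is_cov lambda mu kappa 'I_2 lambda)
    (d : Order.disp_t) (P : porderType d)
    (hP : is_cofinality P lambda) :
  exists A : set P, antichain A /\ A #= [set: kappa].
Proof.
have [[Cof [Cofcof Cofcard]] cfmin] := hP.
have [e eE] := card_eq_range Cofcard.
pose r x y := e x <= e y.
have [Y rY|z zP] := @separating_family _ _ _ hmu hkappa hcf hcov r.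
  (* The image under [e] of an [r]-dominating [Y] is cofinal in [P], so it has size at least
     [lambda]. *)
  apply: card_le_trans (card_image_le e Y); apply: cfmin => p.
  have [q + pq] := Cofcof p; rewrite -eE => -[x _ xq]; rewrite -xq in pq.
  by have [y Yy xy] := rY x; exists (e y); [exists y|exact: le_trans pq xy].
pose sparse (A : set lambda) := (forall a, A a -> forall i g, ~ r a (z i g)) /\
  (forall a b, A a -> A b -> a <> b -> unrelated r a b).
have [F Fsparse totF|A [[Az Aunrel] Amax]] := @Zorn_bigcup _ sparse.
  split=> [a [X /Fsparse[Xz _] /Xz//]|a b [X FX Xa] [Y FY Yb]].
  have [XY|YX] := totF X Y FX FY.
    by have [_] := Fsparse Y FY; apply=> //; exact: XY.
  by have [_] := Fsparse X FX; apply=> //; exact: YX.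
have : [set: kappa] #<= A.
  apply: contrapT => /card_ltE/zP/(_ Az)[x xz xA].
  have Nx : ~ A x by move=> /xA[]; rewrite /r lexx.
  case: (Amax (A `|` [set x])).
    by split=> [a ?|/(_ x (or_intror erefl))//]; left.
  split=> [a [/Az//|->//]|a b [Aa|->] [Ab|->]] //.
  - exact: Aunrel.
  - by have [] := xA a Aa.
  - by move=> _; exact: xA.
move=> /card_le_relP[K [totK injK]].
have /choice[f fP] g : exists a, A a /\ K g a.
  by have [a Aa Ka] := totK g I; exists a.
have Af g : A (f g) by have [] := fP g.
(* [e] may repeat values, but by reflexivity indices with equal values are [r]-related, so it is
   injective on [A]. *)
have ef_inj : injective (e \o f).
  move=> g h /= efgh; have fgh : f g = f h.
    apply: contrapT => /(Aunrel _ _ (Af g) (Af h))[].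
    by rewrite /r efgh lexx.
  apply: (injK g h (f g)) => //; first by have [] := fP g.
  by rewrite fgh; have [] := fP h.
exists (range (e \o f)); split; last exact: inj_card_eq (in2W ef_inj).
move=> _ _ [g _ <-] [h _ <-] /= Nefgh.
have Nfgh : f g <> f h by move=> fgh; apply: Nefgh; rewrite fgh.
have [/negP Ngh /negP Nhg] := Aunrel _ _ (Af g) (Af h) Nfgh.
by rewrite /Order.comparable negb_or; apply/andP.
Qed.
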